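(* Let $P$ be a finite poset. If the cover graph of $P$ has pathwidth at most $2$, then $\dim(P)\leq 17$.
   Context: For a poset $P$, $x$ is covered by $y$ if $x<y$ and there is no $z$ with $x<z<y$. The cover graph of $P$ is the graph on the elements of $P$ in which $x$ and $y$ are adjacent iff one covers the other. The dimension $\dim(P)$ is the least $t$ such that there are linear extensions $L_1,\dots,L_t$ of $P$ with $x<_P y$ iff $x<_{L_i}y$ for all $i$. A path-decomposition of a graph $G=(V,E)$ is a sequence of subsets (bags) $V_1,\dots,V_n$ of $V$ whose union is $V$, such that every edge lies in some bag, and whenever $i<j<k$ we have $V_i\cap V_k\subseteq V_j$; its width is $\max_i|V_i|-1$, and the pathwidth of $G$ is the minimum width of a path-decomposition of $G$. *)

(* Defs.v *)
From HB Require Import structures.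
From mathcomp Require Import all_boot all_order boolp.

Set Implicit Arguments.
Unset Strict Implicit.
Unset Printing Implicit Defensive.

Import Order.TTheory.

Local Open Scope order_scope.

Section CoverGraph.
Variables (d : Order.disp_t) (P : finPOrderType d).

Definition covered (x y : P) : bool :=
  (x < y) && ~~ [exists z, (x < z) && (z < y)].

Definition cover_graph : rel P :=
  [rel x y | covered x y || covered y x].

End CoverGraph.

Section PathWidth.
Variables (T : finType) (e : rel T).

Definition path_decomposition (V : seq {set T}) : Prop :=
  [/\ \bigcup_(B <- V) B = [set: T],
      forall x y, e x y -> exists2 B, B \in V & (x \in B) && (y \in B)
    & forall i j k, (i < j < k)%N -> (k < size V)%N ->
        nth set0 V i :&: nth set0 V k \subset nth set0 V j].

(* The predecessor is truncated: when all bags are empty, which forces T to be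
   empty, the width is 0 instead of -1. *)
Definition width (V : seq {set T}) : nat := (\max_(B <- V) #|B|).-1.

Definition has_width (k : nat) : Prop :=
  exists2 V, path_decomposition V & width V = k.

Lemma ex_has_width : exists k, `[< has_width k >].
Proof.
exists (width [:: [set: T]]); apply/asboolP; exists [:: [set: T]] => //; split.
- by rewrite big_seq1.
- by move=> x y _; exists [set: T]; rewrite ?mem_head ?inE.
- by move=> i j [|k] //; rewrite ltn0 andbF.
Qed.

Definition pathwidth : nat := ex_minn ex_has_width.

End PathWidth.

Section Dimension.
Variables (d : Order.disp_t) (P : finPOrderType d).

(* L is the reflexive order relation of the linear extension. *)
Definition linear_extension (L : rel P) : Prop :=
  [/\ reflexive L, antisymmetric L, transitive L, total L
    & forall x y, x <= y -> L x y].

Definition strict (L : rel P) : rel P := [rel x y | (x != y) && L x y].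

Definition realizer (t : nat) (L : 'I_t -> rel P) : Prop :=
  (forall i, linear_extension (L i)) /\
  (forall x y, x < y <-> forall i, strict (L i) x y).

Definition has_realizer (t : nat) : Prop :=
  exists L : 'I_t -> rel P, realizer L.

Definition add_pair (r : rel P) (x y : P) : rel P :=
  [rel a b | r a b || r a x && r y b].

Lemma add_pair_order (r : rel P) x y :
    reflexive r -> antisymmetric r -> transitive r -> ~~ r y x ->
  [/\ reflexive (add_pair r x y), antisymmetric (add_pair r x y)
    & transitive (add_pair r x y)].
Proof.
move=> rr ra rt nyx.
have K a : r y a -> r a x -> False.
  by move=> ya ax; move: nyx; rewrite (rt _ _ _ ya ax).
rewrite /add_pair; split=> [a|a b|b a c] /=; first by rewrite rr.
- case/andP=> /orP[ab|/andP[ax yb]] /orP[ba|/andP[bx ya]].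
  + by apply: ra; rewrite ab.
  + by case: (K a) => //; apply: rt ab bx.
  + by case: (K b) => //; apply: rt ba ax.
  + by case: (K b).
- case/orP=> [ab|/andP[ax yb]] /orP[bc|/andP[bx yc]].
  + by rewrite (rt _ _ _ ab bc).
  + by rewrite (rt _ _ _ ab bx) yc orbT.
  + by rewrite ax (rt _ _ _ yb bc) orbT.
  + by case: (K b).
Qed.

Lemma total_extension (r : rel P) :
    reflexive r -> antisymmetric r -> transitive r ->
  exists L : rel P, [/\ reflexive L, antisymmetric L, transitive L, total L
    & forall x y, r x y -> L x y].
Proof.
have [n] := ubnP #|[set p | ~~ r p.1 p.2]|.
elim: n r => // n IH r ltn rr ra rt.
case: (pickP [pred p | ~~ r p.1 p.2 && ~~ r p.2 p.1]) => [[x y] /=|tot].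
  case/andP=> nxy nyx.
  have [ar aa at_] := add_pair_order rr ra rt nyx.
  case: (IH (add_pair r x y)) => // [|L [Lr La Lt Ltot LE]].
    apply: leq_trans (_ : _ < #|[set p | ~~ r p.1 p.2]|)%N _; last by [].
    apply: proper_card; apply/properP; split.
      by apply/subsetP => p; rewrite !inE /add_pair /= negb_or => /andP[].
    by exists (x, y); rewrite !inE /= ?nxy /add_pair /= ?rr ?orbT.
  by exists L; split=> // a b ab; apply: LE; rewrite /add_pair /= ab.
exists r; split=> // x y; move: (tot (x, y)) => /=.
by case: (r x y) => //=; case: (r y x).
Qed.

Lemma separating_extension (p : P * P) : exists L : rel P,
  linear_extension L /\ (~~ (p.1 < p.2) -> ~~ strict L p.1 p.2).
Proof.
case: p => x y /=.
have [xy|nxy] := boolP (x <= y).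
  have [L LE] := total_extension (@lexx _ P) (@le_anti _ P) (@le_trans _ P).
  exists L; split=> //.
  by rewrite lt_neqAle xy andbT negbK => /eqP->; rewrite /strict /= eqxx.
have [ar aa at_] :=
  add_pair_order (@lexx _ P) (@le_anti _ P) (@le_trans _ P) nxy.
have [L [Lr La Lt Ltot LE]] := total_extension ar aa at_.
exists L; split=> [|_]; first by split=> // a b ab; apply: LE; rewrite /add_pair /= ab.
apply/negP => /andP[/eqP neq Lxy]; apply: neq; apply: La.
by rewrite Lxy LE // /add_pair /= !lexx orbT.
Qed.

Lemma ex_has_realizer : exists t, `[< has_realizer t >].
Proof.
have [F FP] := choice separating_extension.
exists #|{: P * P}|; apply/asboolP; exists (fun i => F (enum_val i)).
split=> [i|x y]; first by case: (FP (enum_val i)).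
split=> [xy i|H].
  case: (FP (enum_val i)) => [[_ _ _ _ LE] _].
  by rewrite /strict /= LE ?ltW // lt_eqF.
apply: contraT => /(proj2 (FP (x, y))) /=.
by have := H (enum_rank (x, y)); rewrite enum_rankK => ->.
Qed.

Definition poset_dim : nat := ex_minn ex_has_realizer.

End Dimension.

(* Main.v *)
(** Order the vertices by the first bag containing them. Every initial segment
    is then separated from the rest by a set [{a, b}] of at most two vertices,
    so a comparability between the two sides passes through [a] or [b]. The dual
    order has the same layout, so it suffices to reverse, with boundedly many
    linear extensions, the pairs [~ x <= y] in which [x] precedes [y]. If
    no element from [y] onwards lies above [x], or no element preceding [y] lies
    below [y], one of two explicit extensions does it. The other pairs
    satisfy, at the separator just before [y], [x <= a] and [b <= y] or
    vice versa. Two extensions, built by adding the vertices one by one, take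
    care of them: in the first, everything below [a] but not below [b] stays
    above [b]; in the second the roles of [a] and [b] are exchanged. Then
    inserting [y] just above [b] in the first, or just above [a] in the second,
    reverses the pair, and this invariant can be transferred to the next
    separator by inserting the new vertex as low or as high as possible.
    Altogether 2 * (2 + 2) = 8 linear extensions suffice. *)

Require Import Defs.
From HB Require Import structures.
From mathcomp Require Import all_boot all_order boolp.
From mathcomp Require Import zify.

Set Implicit Arguments.
Unset Strict Implicit.
Unset Printing Implicit Defensive.

Import Order.TTheory.

(** * Inserting one element into an integer-valued key *)

Section Insertion.
Variables (T : finType) (le : rel T).
Implicit Types (X : {set T}) (f g : T -> nat) (a b c x y : T).

(** Linear orders under construction are encoded by integer keys, so that inserting an element
    amounts to rescaling the old keys and picking a value in a gap. *)
Definition increasing_on X f :=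
  {in X &, forall x y, le x y -> x != y -> f x < f y}.

Definition same_order_on X f g := {in X &, forall x y, (g x < g y) = (f x < f y)}.

Lemma increasing_on_leq X f :
  increasing_on X f -> {in X &, forall x y, le x y -> f x <= f y}.
Proof.
move=> inc x y xX yX lexy; case: (eqVneq x y) => [->//|neq].
by rewrite ltnW // inc.
Qed.

Hypotheses (le_refl : reflexive le) (le_trans : transitive le) (le_anti : antisymmetric le).

Let le_antiF x y : x != y -> le x y -> le y x -> False.
Proof. by move=> /eqP ne xy yx; apply/ne/le_anti; rewrite xy. Qed.

Lemma insert_low X c f : c \notin X -> increasing_on X f ->
  exists g, [/\ increasing_on (c |: X) g, same_order_on X f g
    & {in X, forall y,
        {in X, forall z, le z c -> f z < f y} -> g c < g y}].
Proof.
move=> cX inc.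
(* Old keys become even and at least 2, [c] gets an odd key just above all its lower bounds; if
   there are none, [m = 0] and [c] goes to the bottom. *)
pose m := \max_(z in X | le z c) (f z).+1.
exists (fun x => if x == c then m.*2.+1 else (f x).+1.*2).
have ne x : x \in X -> (x == c) = false by move=> xX; apply: contraNF cX => /eqP<-.
have lt_m y : {in X, forall z, le z c -> f z < f y} -> m <= f y.
  by move=> lt; apply/bigmax_leqP => z /andP[zX zc]; apply: lt.
split.
- move=> x y /setU1P[->|xX] /setU1P[->|yX]; rewrite ?eqxx ?ne //.
  + move=> cy ncy; suff: m <= f y by lia.
    apply: lt_m => z zX zc; apply: inc => //; first exact: le_trans zc cy.
    by apply/eqP => zy; apply: (le_antiF ncy cy); rewrite -zy.
  + move=> xc _; suff: (f x).+1 <= m by lia.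
    by rewrite /m (bigop.bigmax_sup x) // xX.
  + by move=> xy nxy; have := inc x y xX yX xy nxy; lia.
- by move=> x y xX yX; rewrite !ne //; lia.
- by move=> y yX lt; rewrite eqxx ne //; have := lt_m y lt; lia.
Qed.

Lemma insert_high X c f : c \notin X -> increasing_on X f ->
  exists g, [/\ increasing_on (c |: X) g, same_order_on X f g
    & {in X, forall y,
        {in X, forall z, le c z -> f y < f z} -> g y < g c}].
Proof.
move=> cX inc.
pose N := (\max_x f x).+1.
have fN x : f x < N by rewrite ltnS leq_bigmax.
(* [N - m] is the least key above [c], or [N] if nothing in [X] lies above [c], which then goes to
   the top. *)
pose m := \max_(z in X | le c z) (N - f z).
exists (fun x => if x == c then (N - m).*2 else (f x).*2.+1).
have ne x : x \in X -> (x == c) = false by move=> xX; apply: contraNF cX => /eqP<-.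
have lt_m y : {in X, forall z, le c z -> f y < f z} -> f y < N - m.
  move=> lt; suff: m <= N - (f y).+1 by have := fN y; lia.
  by apply/bigmax_leqP => z /andP[zX zc]; have := lt z zX zc; lia.
split.
- move=> x y /setU1P[->|xX] /setU1P[->|yX]; rewrite ?eqxx ?ne //.
  + move=> cy _; suff: N - f y <= m by have := fN y; lia.
    by rewrite /m (bigop.bigmax_sup y) // yX.
  + move=> xc _; suff: f x < N - m by lia.
    apply: lt_m => z zX cz; apply: inc => //; first exact: le_trans xc cz.
    by apply/eqP => xz; apply: (le_antiF _ xc); rewrite ?ne // xz.
  + by move=> xy nxy; have := inc x y xX yX xy nxy; lia.
- by move=> x y xX yX; rewrite !ne //; lia.
- by move=> y yX lt; rewrite eqxx ne //; have := lt_m y lt; lia.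
Qed.

Definition separated X a b := {in X, forall x y, y \notin X ->
  (le x y -> le x a && le a y || le x b && le b y) /\
  (le y x -> le y a && le a x || le y b && le b x)}.

Definition lifted X f b a := {in X, forall x, le x a -> ~~ le x b -> f b < f x}.

(** * Preserving the lift invariant from one separator to the next *)

Section Step.
Variables (X : {set T}) (c : T).
Hypothesis cX : c \notin X.

Definition reverses a b g1 g2 := {in X, forall x, ~~ le x c ->
  le x a || le x b -> le a c || le b c -> g1 c < g1 x \/ g2 c < g2 x}.

Definition refines f1 f2 g1 g2 a b a' b' :=
  [/\ increasing_on (c |: X) g1 /\ same_order_on X f1 g1,
      increasing_on (c |: X) g2 /\ same_order_on X f2 g2,
      lifted (c |: X) g1 b' a', lifted (c |: X) g2 a' b'
    & reverses a b g1 g2].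

(** Exchanging the two keys together with the two separator vertices halves the case analysis
    below. *)
Lemma refinesC f1 f2 g1 g2 a b a' b' :
  refines f1 f2 g1 g2 a b a' b' -> refines f2 f1 g2 g1 b a b' a'.
Proof.
case=> i1 i2 l1 l2 rev; split=> // x xX nxc xab abc.
by rewrite orbC in xab; rewrite orbC in abc; case: (rev x xX nxc xab abc); [right|left].
Qed.

Lemma separatedC a b : separated X a b -> separated X b a.
Proof.
by move=> sep x xX y yX; have [up dn] := sep x xX y yX; split=> h;
  rewrite orbC; [exact: up|exact: dn].
Qed.

Section Insert.
Variables (a b : T) (f1 f2 : T -> nat).
Hypotheses (aX : a \in X) (bX : b \in X) (sep : separated X a b).
Hypotheses (inc1 : increasing_on X f1) (inc2 : increasing_on X f2).
Hypotheses (lift1 : lifted X f1 b a) (lift2 : lifted X f2 a b).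

Let sepU x : x \in X -> le x c -> le x a && le a c || le x b && le b c.
Proof. by move=> xX; case: (sep xX cX). Qed.

Let sepD x : x \in X -> le c x -> le c a && le a x || le c b && le b x.
Proof. by move=> xX; case: (sep xX cX). Qed.

Let neq_c x : x \in X -> x != c.
Proof. by move=> xX; apply: contraNneq cX => <-. Qed.

(* If [a <= c] too then [le x a || le x b] contradicts [~~ le x c];
   otherwise everything below [c] is below [b], so [c] ends up just above [b]. *)
Lemma reverses_low1 g1 g2 : le b c ->
    {in X, forall y, {in X, forall z, le z c -> f1 z < f1 y} -> g1 c < g1 y} ->
  reverses a b g1 g2.
Proof.
move=> bc low x xX nxc xab _; left; apply: low => // z zX zc.
have nxb : ~~ le x b by apply: contra nxc => xb; apply: le_trans xb bc.
have xa : le x a by move: xab; rewrite (negPf nxb) orbF.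
have nac : ~~ le a c by apply: contra nxc; apply: le_trans xa.
have zb : le z b by have := sepU zX zc; rewrite (negPf nac) andbF /= => /andP[].
exact: leq_ltn_trans (increasing_on_leq inc1 zX bX zb) (lift1 xX xa nxb).
Qed.

(** An upper bound of [c] in [X] lies above [a], and [c <= a] without [c <= b] excludes [a <= b]. So
    [lifted] puts [a], and with it every such upper bound, above [b]. *)
Lemma above_high1 g1 : ~~ le c b ->
    {in X, forall y, {in X, forall z, le c z -> f1 y < f1 z} -> g1 y < g1 c} ->
  g1 b < g1 c.
Proof.
move=> ncb high; apply: high => // z zX cz.
have := sepD zX cz; rewrite (negPf ncb) orbF => /andP[ca az].
apply: leq_trans (increasing_on_leq inc1 aX zX az).
by apply: lift1 => //; apply: contra ncb; apply: le_trans ca.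
Qed.

(** Here [c] takes the place of [a]. If [b <= c], the second lift condition is vacuous and low
    insertion works in both keys. Otherwise all elements of [X] below [c] are below [a]: low
    insertion in the second key puts [c] under everything below [b] but not below [c], while high
    insertion in the first keeps [c] above [b] unless [c <= b]. *)
Lemma insert_keep_right : exists g1 g2, refines f1 f2 g1 g2 a b c b.
Proof.
have [bc|nbc] := boolP (le b c).
  have [g1 [i1 s1 low1]] := insert_low cX inc1.
  have [g2 [i2 s2 low2]] := insert_low cX inc2.
  exists g1, g2; split=> //; last exact: reverses_low1.
  - move=> x /setU1P[->|xX] xc nxb.
      by apply: i1 => //; rewrite ?setU11 ?setU1r ?neq_c.
    rewrite s1 //; apply: lift1 => //.
    by have := sepU xX xc; rewrite (negPf nxb) orbF => /andP[].
  - move=> x /setU1P[->|xX] xb nxc; first by rewrite le_refl in nxc.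
    by rewrite (le_trans xb bc) in nxc.
have [g1 [i1 s1 high1]] := insert_high cX inc1.
have [g2 [i2 s2 low2]] := insert_low cX inc2.
have below x : x \in X -> le x b -> ~~ le x c -> g2 c < g2 x.
  move=> xX xb nxc; apply: low2 => // z zX zc.
  have := sepU zX zc; rewrite (negPf nbc) andbF orbF => /andP[za ac].
  apply: leq_ltn_trans (increasing_on_leq inc2 zX aX za) _.
  by apply: lift2 => //; apply: contra nxc => xa; apply: le_trans xa ac.
exists g1, g2; split=> //.
- move=> x /setU1P[->|xX] xc nxb; first exact: above_high1.
  rewrite s1 //; apply: lift1 => //.
  by have := sepU xX xc; rewrite (negPf nxb) orbF => /andP[].
- move=> x /setU1P[->|xX] xb nxc; first by rewrite le_refl in nxc.
  exact: below.
- move=> x xX nxc xab; rewrite (negPf nbc) orbF => ac; right.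
  apply: below => //; case/orP: xab => // xa.
  by rewrite (le_trans xa ac) in nxc.
Qed.

Lemma insert_keep_both_above : le b c ->
  exists g1 g2, refines f1 f2 g1 g2 a b a b.
Proof.
move=> bc.
have [g1 [i1 s1 low1]] := insert_low cX inc1.
have [g2 [i2 s2 low2]] := insert_low cX inc2.
exists g1, g2; split=> //; last exact: reverses_low1.
- move=> x /setU1P[->|xX] xa nxb; last by rewrite s1 //; apply: lift1.
  by apply: i1 => //; rewrite ?setU11 ?setU1r ?neq_c.
- move=> x /setU1P[->|xX] xb nxa; last by rewrite s2 //; apply: lift2.
  by case: (le_antiF (neq_c bX) bc xb).
Qed.

End Insert.

Lemma insert_keep_both a b f1 f2 : a \in X -> b \in X -> separated X a b ->
    increasing_on X f1 -> increasing_on X f2 ->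
    lifted X f1 b a -> lifted X f2 a b ->
  exists g1 g2, refines f1 f2 g1 g2 a b a b.
Proof.
move=> aX bX sep inc1 inc2 lift1 lift2.
have [bc|nbc] := boolP (le b c); first exact: insert_keep_both_above.
have [ac|nac] := boolP (le a c).
  have [g2 [g1 /refinesC r]] :=
    insert_keep_both_above bX aX (separatedC sep) inc2 inc1 lift2 lift1 ac.
  by exists g1, g2.
(* With neither [a] nor [b] below [c] there is no pair to reverse, so [c] may go high in both keys,
   as the lift conditions ask. *)
have [g1 [i1 s1 high1]] := insert_high cX inc1.
have [g2 [i2 s2 high2]] := insert_high cX inc2.
exists g1, g2; split=> //.
- move=> x /setU1P[->|xX] xa nxb; last by rewrite s1 //; apply: lift1.
  exact: (above_high1 aX bX sep inc1 lift1).
- move=> x /setU1P[->|xX] xb nxa; last by rewrite s2 //; apply: lift2.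
  exact: (above_high1 bX aX (separatedC sep) inc2 lift2).
- by move=> x _ _ _; rewrite (negPf nac) (negPf nbc).
Qed.

(** [S] stands for the next boundary. Having at most two elements among [a], [b], [c], it misses one
    of them or two of them coincide, which decides the vertices to keep. *)
Lemma insert_step (S : {set T}) a b f1 f2 :
    a \in X -> b \in X -> separated X a b ->
    increasing_on X f1 -> increasing_on X f2 ->
    lifted X f1 b a -> lifted X f2 a b ->
    S \subset c |: [set a; b] -> #|S| <= 2 ->
  exists a' b' g1 g2, [/\ a' \in c |: X, b' \in c |: X, S \subset [set a'; b']
    & refines f1 f2 g1 g2 a b a' b'].
Proof.
move=> aX bX sep inc1 inc2 lift1 lift2 /subsetP Ssub S2.
have cS : c \in c |: X by rewrite setU11.
have [aS|aS] := boolP (a \in S); last first.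
  have [g1 [g2 r]] := insert_keep_right aX bX sep inc1 inc2 lift1 lift2.
  exists c, b, g1, g2; split; rewrite ?cS ?setU1r //.
  apply/subsetP => x xS; have := Ssub x xS; rewrite !inE => /or3P[->//|/eqP xa|->].
    by rewrite xa (negPf aS) in xS.
  by rewrite orbT.
have [bS|bS] := boolP (b \in S); last first.
  have [g2 [g1 /refinesC r]] :=
    insert_keep_right bX aX (separatedC sep) inc2 inc1 lift2 lift1.
  exists a, c, g1, g2; split; rewrite ?cS ?setU1r //.
  apply/subsetP => x xS; have := Ssub x xS; rewrite !inE => /or3P[->|->|/eqP xb] //.
    by rewrite orbT.
  by rewrite xb (negPf bS) in xS.
have [ab|nab] := eqVneq a b.
  have [g1 [g2 r]] := insert_keep_right aX bX sep inc1 inc2 lift1 lift2.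
  exists c, b, g1, g2; split; rewrite ?cS ?setU1r //.
  by apply/subsetP => x xS; have := Ssub x xS; rewrite ab !inE orbb.
have [g1 [g2 r]] := insert_keep_both aX bX sep inc1 inc2 lift1 lift2.
exists a, b, g1, g2; split; rewrite ?cS ?setU1r //.
have sub : [set a; b] \subset S by apply/subsetP => x; rewrite !inE => /orP[] /eqP->.
suff /eqP-> : [set a; b] == S by [].
by rewrite eqEcard sub cards2 nab.
Qed.

End Step.
End Insertion.

(** * Reversing keys along a layout with small boundaries *)

Section Layout.
Variables (T : finType) (e : rel T) (pos : T -> nat).

Definition boundary (X : {set T}) := [set u in X | [exists w, (w \notin X) && e u w]].

Definition prefix (i : nat) : {set T} := [set x | pos x < i].

(** Stated for an arbitrary relation, so that an order and its dual can share one layout. *)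
Definition crosses_boundary (le : rel T) :=
  forall X : {set T}, {in X, forall x y, y \notin X ->
  (le x y -> exists2 z, z \in boundary X & le x z && le z y) /\
  (le y x -> exists2 z, z \in boundary X & le y z && le z x)}.

Lemma prefixS c : injective pos -> prefix (pos c).+1 = c |: prefix (pos c).
Proof.
move=> pos_inj; apply/setP => x; rewrite !inE ltnS leq_eqVlt.
by rewrite (inj_eq pos_inj).
Qed.

Lemma boundaryU1 c X : boundary (c |: X) \subset c |: boundary X.
Proof.
apply/subsetP => u; rewrite !inE => /andP[/orP[->//|uX]] /existsP[w].
rewrite !inE negb_or => /andP[/andP[_ wX] uw]; rewrite uX orbC /=.
by apply/orP; left; apply/existsP; exists w; rewrite wX.
Qed.

Variable le : rel T.
Hypotheses (le_refl : reflexive le) (le_trans : transitive le).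
Hypotheses (le_anti : antisymmetric le) (pos_inj : injective pos).
Hypothesis crossing : crosses_boundary le.

Lemma boundary_separated X a b : boundary X \subset [set a; b] -> separated le X a b.
Proof.
move=> /subsetP sub x xX y yX; have [up dn] := crossing xX yX.
by split=> [/up|/dn] [z /sub]; rewrite !inE => /orP[] /eqP-> ->; rewrite ?orbT.
Qed.

Definition linked x y :=
  (exists2 z, pos y <= pos z & le x z) /\ (exists2 z, pos z < pos y & le z y).

Definition linked_reversed i (f1 f2 : T -> nat) := forall x y,
  pos x < pos y -> pos y < i -> ~~ le x y -> linked x y ->
  f1 y < f1 x \/ f2 y < f2 x.

Hypothesis small_boundary : forall i, #|boundary (prefix i)| <= 2.

(** Induction along the layout by [insert_step]; [x0] makes the prefix nonempty, so that [a] and [b]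
    can be chosen in it. *)
Lemma prefix_keys i x0 : pos x0 < i -> exists a b f1 f2,
  [/\ a \in prefix i, b \in prefix i & boundary (prefix i) \subset [set a; b]] /\
  [/\ increasing_on le (prefix i) f1, increasing_on le (prefix i) f2,
      lifted le (prefix i) f1 b a, lifted le (prefix i) f2 a b
    & linked_reversed i f1 f2].
Proof.
elim: i => // i IH in x0 *; rewrite ltnS => x0i.
case: (pickP (fun c => pos c == i)) => [c /eqP ci|no]; last first.
  (* Positions may have gaps: if none is equal to [i], the prefix does not change. *)
  have /IH : pos x0 < i by rewrite ltn_neqAle no.
  have -> : prefix i.+1 = prefix i.
    by apply/setP => x; rewrite !inE ltnS leq_eqVlt no.
  move=> [a [b [f1 [f2 [ab [i1 i2 l1 l2 rev]]]]]].
  exists a, b, f1, f2; do 2!split=> //; move=> x y xy.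
  by rewrite ltnS leq_eqVlt no; apply: rev.
have cX : c \notin prefix i by rewrite inE ci ltnn.
have pS : prefix i.+1 = c |: prefix i by rewrite -ci prefixS.
rewrite pS; case: (pickP (mem (prefix i))) => [x1 /= x1i|X0]; last first.
  have {}X0 : prefix i = set0 by apply/setP => x; rewrite in_set0; apply: X0.
  rewrite X0 setU0 in pS *.
  (* For the first element both separator vertices are [c], which makes the lift conditions
     vacuous. *)
  exists c, c, (fun=> 0), (fun=> 0); split.
    by split; rewrite ?set11 //; apply/subsetP => x; rewrite !inE => /andP[->].
  have one x : x \in [set c] -> x = c by move/set1P.
  split.
  - by move=> x y /one-> /one->; rewrite eqxx.
  - by move=> x y /one-> /one->; rewrite eqxx.
  - by move=> x /one->; rewrite le_refl.
  - by move=> x /one->; rewrite le_refl.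
  - move=> x y xy yi; have: x \in [set c] by rewrite -pS inE (ltn_trans xy).
    move/one => xc; have: y \in [set c] by rewrite -pS inE.
    by move/one => yc; rewrite xc yc ltnn in xy.
have := IH x1; rewrite inE in x1i; case=> // a [b [f1 [f2 []]]].
move=> [aX bX sub] [inc1 inc2 l1 l2 rev].
have sep := boundary_separated sub.
have S2 : #|boundary (c |: prefix i)| <= 2 by rewrite -pS.
have Ssub : boundary (c |: prefix i) \subset c |: [set a; b].
  by apply: subset_trans (boundaryU1 _ _) _; apply: setUS.
have [a' [b' [g1 [g2 [a'X b'X S' [[i1 s1] [i2 s2] l1' l2' rev']]]]]] :=
  insert_step le_refl le_trans le_anti cX aX bX sep inc1 inc2 l1 l2 Ssub S2.
exists a', b', g1, g2; do 2!split=> //.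
move=> x y xy; rewrite ltnS leq_eqVlt => /orP[/eqP yi|yi] nxy lnk; last first.
  have xX : x \in prefix i by rewrite inE (ltn_trans xy).
  have yX : y \in prefix i by rewrite inE.
  by rewrite s1 // s2 //; apply: rev.
have yc : y = c by apply: pos_inj; rewrite ci.
rewrite {}yc {yi} in xy nxy lnk *.
have xX : x \in prefix i by rewrite inE -ci.
have [[z cz xz] [t tc tlec]] := lnk.
have zX : z \notin prefix i by rewrite inE -leqNgt -ci.
have tX : t \in prefix i by rewrite inE -ci.
(* Both comparabilities cross the separator: [x <= z] gives [x <= a] or [x <= b], and [t <= c] gives
   [a <= c] or [b <= c]. *)
apply: rev' => //.
  by have [/(_ xz) /orP[]/andP[->]] := sep x xX z zX; rewrite ?orbT.
by have [/(_ tlec) /orP[]/andP[_ ->]] := sep t tX c cX; rewrite ?orbT.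
Qed.

(** Ties are allowed even between comparable elements; they are broken when the key is turned into a
    linear extension. *)
Definition monotone (f : T -> nat) := forall x y, le x y -> f x <= f y.

Lemma prefix_keys_total : exists f1 f2, [/\ monotone f1, monotone f2
  & forall x y, pos x < pos y -> ~~ le x y -> linked x y -> f1 y < f1 x \/ f2 y < f2 x].
Proof.
case: (pickP T) => [x0 _|T0]; last by exists (fun=> 0), (fun=> 0); split=> // x; have:= T0 x.
pose n := (\max_x pos x).+1.
have pn x : pos x < n by rewrite ltnS leq_bigmax.
have [a [b [f1 [f2 [_ [i1 i2 _ _ rev]]]]]] := prefix_keys (pn x0).
have inP x : x \in prefix n by rewrite inE.
exists f1, f2; split.
- by move=> x y; apply: (increasing_on_leq i1).
- by move=> x y; apply: (increasing_on_leq i2).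
- by move=> x y xy nxy lnk; apply: rev.
Qed.

Lemma reversing_keys : exists F : 'I_4 -> T -> nat,
  (forall k, monotone (F k)) /\
  (forall x y, pos x < pos y -> ~~ le x y -> exists k, F k y < F k x).
Proof.
have [f1 [f2 [m1 m2 rev]]] := prefix_keys_total.
(* [f3] decreases with the last position above an element, [f4] with the
   first position below it; they reverse the pairs that are not linked. *)
pose f3 x := #|[set z | [forall u, le x u ==> (pos u < pos z)]]|.
pose f4 y := #|[set z | [exists u, le u y && (pos u <= pos z)]]|.
exists (fun k => nth (fun=> 0) [:: f1; f2; f3; f4] k); split.
  case=> [[|[|[|[|//]]]]] _ //= x y xy.
  - apply/subset_leq_card/subsetP => z; rewrite !inE => /forallP h.
    apply/forallP => u; apply/implyP => yu; have := h u.
    by rewrite (le_trans xy yu).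
  - apply/subset_leq_card/subsetP => z; rewrite !inE => /existsP[u /andP[ux uz]].
    by apply/existsP; exists u; rewrite (le_trans ux xy).
move=> x y xy nxy.
have [up|nup] := boolP [exists z, (pos y <= pos z) && le x z]; last first.
  exists (inord 2); rewrite inordK //=.
  have {}nup u : le x u -> pos u < pos y.
    by move=> xu; rewrite ltnNge; apply: contra nup => yu; apply/existsP; exists u; rewrite yu.
  apply/proper_card/properP; split.
    apply/subsetP => z; rewrite !inE => /forallP h; apply/forallP => u.
    apply/implyP => xu; apply: ltn_trans (nup u xu) _.
    by have := h y; rewrite le_refl.
  (* [y] is counted in [f3 x], since everything above [x] precedes it, but not in [f3 y]. *)
  exists y; rewrite !inE; first by apply/forallP => u; apply/implyP/nup.
  by apply/forallPn; exists y; rewrite le_refl ltnn.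
have [dn|ndn] := boolP [exists z, (pos z < pos y) && le z y]; last first.
  exists (inord 3); rewrite inordK //=.
  have {}ndn u : le u y -> pos y <= pos u.
    by move=> uy; rewrite leqNgt; apply: contra ndn => yu; apply/existsP; exists u; rewrite yu.
  apply/proper_card/properP; split.
    apply/subsetP => z; rewrite !inE => /existsP[u /andP[uy uz]]; apply/existsP.
    exists x; rewrite le_refl ltnW // (leq_trans xy) // (leq_trans _ uz) //.
    exact: ndn.
  exists x; rewrite !inE; first by apply/existsP; exists x; rewrite le_refl leqnn.
  apply/existsPn => u; apply/negP => /andP[/ndn uy ux].
  by have := leq_trans uy ux; rewrite leqNgt xy.
have lnk : linked x y.
  move: up dn => /existsP[z /andP[yz xz]] /existsP[t /andP[ty tley]].
  by split; [exists z|exists t].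
case: (rev x y xy nxy lnk) => lt; [exists (inord 0)|exists (inord 1)];
  by rewrite inordK.
Qed.

End Layout.

(** * The layout given by a path-decomposition *)

Section PathDecomposition.
Variables (T : finType) (e : rel T) (V : seq {set T}).
Hypothesis decV : path_decomposition e V.

Definition first_bag x := find (fun B : {set T} => x \in B) V.

(** Lexicographic code: the rank, smaller than [#|T|], breaks ties between elements with the same
    first bag and makes positions distinct. *)
Definition bag_position x := first_bag x * #|T| + enum_rank x.

Lemma bag_position_inj : injective bag_position.
Proof.
move=> x y eq_xy; apply: enum_rank_inj; apply: val_inj => /=.
have := congr1 (modn^~ #|T|) eq_xy; rewrite /bag_position /=.
by rewrite !modnMDl !modn_small.
Qed.

Lemma bag_position_lt x y :
  bag_position x < bag_position y -> first_bag x <= first_bag y.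
Proof.
rewrite /bag_position (leqNgt (first_bag x)) => xy; apply/negP => lt_yx.
have h : (first_bag y).+1 * #|T| <= first_bag x * #|T| by rewrite leq_mul2r lt_yx orbT.
have := leq_trans (leq_trans h (leq_addr _ _)) (ltnW xy).
by rewrite mulSn addnC leq_add2l leqNgt ltn_ord.
Qed.

Lemma has_bag x : has (fun B : {set T} => x \in B) V.
Proof.
case: decV => cov _ _; have := in_setT x; rewrite -cov bigcup_seq.
by case/bigcupP => B BV xB; apply/hasP; exists B.
Qed.

Lemma mem_first_bag x : x \in nth set0 V (first_bag x).
Proof. exact: (nth_find set0 (has_bag x)). Qed.

Lemma first_bag_leq x j : j < size V -> x \in nth set0 V j -> first_bag x <= j.
Proof.
by move=> jV xj; rewrite leqNgt; apply/negP => /(before_find set0); rewrite xj.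
Qed.

Lemma mem_between x j k : first_bag x <= j <= k -> k < size V ->
  x \in nth set0 V k -> x \in nth set0 V j.
Proof.
move=> /andP[xj jk] kV xk; case: decV => _ _ conv.
have xf := mem_first_bag x.
move: xj; rewrite leq_eqVlt => /orP[/eqP<- //|xj].
move: jk; rewrite leq_eqVlt => /orP[/eqP-> //|jk].
have ij : first_bag x < j < k by rewrite xj.
by apply: (subsetP (conv _ _ _ ij kV)); rewrite inE xf.
Qed.

(** Let [w] outside the prefix have the earliest first bag. A boundary vertex [u] starts no later
    than that bag and shares a bag, no earlier than it, with a neighbour outside the prefix. So the
    first bag of [w] contains the whole boundary besides [w] itself. *)
Lemma card_boundary_prefix i m : (forall B, B \in V -> #|B| <= m.+1) ->
  #|boundary e (prefix bag_position i)| <= m.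
Proof.
move=> Bm; case: (pickP (mem (~: prefix bag_position i))) => [w0 w0X|X0]; last first.
  suff -> : boundary e (prefix bag_position i) = set0 by rewrite cards0.
  apply/setP => u; rewrite in_set0 inE; apply/andP => -[_ /existsP[w /andP[wX _]]].
  by have := X0 w; rewrite /= in_setC wX.
case: (arg_minnP first_bag w0X) => w /=; rewrite in_setC => wX w_min.
have wV : first_bag w < size V by rewrite -has_find has_bag.
have card_w : #|nth set0 V (first_bag w) :\ w| <= m.
  by have := Bm _ (mem_nth set0 wV); rewrite (cardsD1 w) mem_first_bag.
apply: leq_trans card_w; apply/subset_leq_card/subsetP => u.
rewrite in_setD1 inE => /andP[uX /existsP[v /andP[vX uv]]].
have -> /= : u != w by apply: contraNneq wX => <-.
have [B BV /andP[uB vB]] : exists2 B, B \in V & (u \in B) && (v \in B).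
  by case: decV => _ + _; apply.
have jV : index B V < size V by rewrite index_mem.
have nB : nth set0 V (index B V) = B by rewrite nth_index.
apply: (@mem_between _ _ (index B V)); rewrite ?nB //; apply/andP; split.
  apply: bag_position_lt; apply: leq_trans (_ : i <= _); first by rewrite inE in uX.
  by rewrite inE -leqNgt in wX.
apply: (@leq_trans (first_bag v)); first by apply: w_min; rewrite /= in_setC.
by apply: first_bag_leq; rewrite ?nB.
Qed.

End PathDecomposition.

(** * Cover graphs, linear extensions and realizers *)

Section Poset.
Variables (d : Order.disp_t) (P : finPOrderType d).
Local Open Scope order_scope.

(** Take [u] maximal in [A] between [x] and [y], then [w] minimal above [u] and below [y]. The size
    [up] of the up-set strictly decreases along the order, so its minimizers are maximal elements
    and its maximizers minimal ones. *)
Lemma cover_crossing (A : {set P}) x y : x \in A -> y \notin A -> x <= y ->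
  exists u w, [/\ u \in A, w \notin A, covered u w, x <= u & w <= y].
Proof.
move=> xA yA xy.
pose up z := #|[set t : P | z <= t]|.
have up_lt z t : z < t -> (up t < up z)%N.
  move=> zt; apply: proper_card; apply/properP; split.
    by apply/subsetP => s; rewrite !inE; apply: le_trans (ltW zt).
  by exists z; rewrite !inE ?lexx // lt_geF.
have x0 : [pred z | [&& z \in A, x <= z & z <= y]] x by rewrite /= xA lexx.
case: (arg_minnP up x0) => u /and3P[uA xu uy] u_min.
have uy' : u < y by rewrite lt_neqAle uy andbT; apply: contraNneq yA => <-.
have y0 : [pred z | (u < z) && (z <= y)] y by rewrite /= uy' lexx.
case: (arg_maxnP up y0) => w /andP[uw wy] w_max.
exists u, w; split=> //.
  apply/negP => wA; have := u_min w; rewrite /= wA wy (le_trans xu (ltW uw)) => /(_ isT).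
  by rewrite leqNgt up_lt.
rewrite /covered uw /=; apply/existsPn => z; apply/negP => /andP[uz zw].
have := w_max z; rewrite /= uz (le_trans (ltW zw) wy) => /(_ isT).
by rewrite /= leqNgt up_lt.
Qed.

Lemma crosses_cover_boundary : crosses_boundary (@cover_graph d P) <=%O.
Proof.
move=> X x xX y yX; split=> [xy|yx].
  have [u [w [uX wX uw xu wy]]] := cover_crossing xX yX xy.
  have uw' : u <= w by case/andP: uw => /ltW.
  exists u; last by rewrite xu (le_trans uw' wy).
  by rewrite inE uX; apply/existsP; exists w; rewrite wX; apply/orP; left.
(* A comparability entering [X] leaves its complement; the upper end of the crossing cover is then
   the boundary vertex. *)
have yC : y \in ~: X by rewrite inE.
have xC : x \notin ~: X by rewrite inE negbK.
have [u [w [uX wX uw yu wx]]] := cover_crossing yC xC yx.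
have uw' : u <= w by case/andP: uw => /ltW.
rewrite inE in uX; rewrite inE negbK in wX; exists w; last by rewrite wx (le_trans yu uw').
by rewrite inE wX; apply/existsP; exists u; rewrite uX; apply/orP; right.
Qed.

Lemma key_extension (f : P -> nat) : monotone <=%O f ->
  exists L, linear_extension L /\ forall x y, (f x < f y)%N -> strict L x y.
Proof.
(* Strict key comparisons never contradict the order of [P], so their union with it is a partial
   order, and any linear extension of it will do. *)
move=> mono; pose r : rel P := fun x y => (x <= y) || (f x < f y)%N.
have rr : reflexive r by move=> x; rewrite /r lexx.
have ra : antisymmetric r.
  move=> x y /andP[/orP[xy|xy] /orP[yx|yx]].
  - by apply/le_anti; rewrite xy.
  - by have := mono _ _ xy; rewrite leqNgt yx.
  - by have := mono _ _ yx; rewrite leqNgt xy.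
  - by have := ltn_trans xy yx; rewrite ltnn.
have rt : transitive r.
  move=> y x z; rewrite /r => /orP[xy|xy] /orP[yz|yz].
  - by rewrite (le_trans xy yz).
  - by rewrite (leq_ltn_trans (mono _ _ xy) yz) orbT.
  - by rewrite (leq_trans xy (mono _ _ yz)) orbT.
  - by rewrite (ltn_trans xy yz) orbT.
have [L [Lr La Lt Ltot rL]] := total_extension rr ra rt.
exists L; split; first by split=> // x y xy; apply: rL; rewrite /r xy.
move=> x y xy; rewrite /strict /= rL ?andbT ?/r ?xy ?orbT //.
by apply: contraTneq xy => ->; rewrite ltnn.
Qed.

Lemma antitone_key (f : P -> nat) : monotone >=%O f ->
  exists g, monotone <=%O g /\ forall x y, (f x < f y)%N -> (g y < g x)%N.
Proof.
move=> anti; pose N := (\max_z f z).+1.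
have fN x : (f x < N)%N by rewrite ltnS leq_bigmax.
exists (fun x => N - f x)%N; split=> x y xy; last by rewrite ltn_sub2l.
exact: leq_sub2l (anti _ _ xy).
Qed.

Lemma realizer_of_reversals t (L : 'I_t.+1 -> rel P) :
    (forall i, linear_extension (L i)) ->
    (forall x y, ~~ (x <= y) -> exists i, strict (L i) y x) ->
  realizer L.
Proof.
move=> Lext rev; split=> // x y; split=> [xy i|sL].
  by case: (Lext i) => _ _ _ _ LE; rewrite /strict /= LE ?ltW // lt_eqF.
(* At least one extension is required here: an empty family would not force [x != y]. *)
have /andP[neq _] := sL ord0.
rewrite lt_neqAle neq /=; apply: contraT => /rev[i /andP[/= nyx Lyx]].
case: (Lext i) => _ La _ _ _; have /andP[_ Lxy] := sL i.
by case/eqP: neq; apply: La; rewrite Lxy.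
Qed.

Lemma poset_dim_leq t : has_realizer P t -> (poset_dim P <= t)%N.
Proof. by move=> rt; rewrite /poset_dim; case: ex_minnP => m _; apply; apply/asboolP. Qed.

End Poset.

(** * From pathwidth to the dimension bound *)

Lemma pathwidth_decomposition (T : finType) (e : rel T) m : pathwidth e <= m ->
  exists2 V, path_decomposition e V & forall B, B \in V -> #|B| <= m.+1.
Proof.
rewrite /pathwidth; case: ex_minnP => k /asboolP[V decV wV] _ km; exists V => // B BV.
have : #|B| <= \max_(B <- V) #|B| by apply: leq_bigmax_seq.
by move: wV; rewrite /width; lia.
Qed.

Lemma poset_dim_pathwidth2 (d : Order.disp_t) (P : finPOrderType d) :
  pathwidth (@cover_graph d P) <= 2 -> poset_dim P <= 8.
Proof.
move=> /pathwidth_decomposition[V decV V3]; apply: poset_dim_leq.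
have pos_inj := @bag_position_inj P V.
have small i := card_boundary_prefix decV i V3.
have [F [monoF revF]] := reversing_keys (@lexx _ P) (@le_trans _ P)
  (@le_anti _ P) pos_inj (@crosses_cover_boundary _ P) small.
have ge_crossing : crosses_boundary (@cover_graph d P) >=%O.
  by move=> X x xX y yX; have [up dn] := crosses_cover_boundary xX yX;
    split=> [/dn|/up] [z zX]; rewrite andbC; exists z.
have [G [monoG revG]] := reversing_keys (le := >=%O) (@lexx _ P) (@ge_trans _ P)
  (@ge_anti _ P) pos_inj ge_crossing small.
have [G' G'P] := choice (fun k => antitone_key (monoG k)).
pose H (k : 'I_4 + 'I_4) := match k with inl k => F k | inr k => G' k end.
have monoH k : monotone <=%O (H k) by case: k => k /=; case: (G'P k).
have [L LP] := choice (fun k : 'I_(4 + 4) => key_extension (monoH (split k))).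
exists L; apply: realizer_of_reversals => [k|x y nxy]; first by case: (LP k).
suff [k lt] : exists k, H k y < H k x.
  by exists (unsplit k); case: (LP (unsplit k)) => _; apply; rewrite unsplitK.
(* If [x] comes first, a key [F k] reverses the pair. If [y] does, some [G k] reverses it for the
   dual order, and [G' k] turns this back to the order of [P]. *)
case: (ltngtP (bag_position V x) (bag_position V y)) => [xy|yx|/pos_inj eqxy].
- by have [k] := revF x y xy nxy; exists (inl k).
- by have [k] := revG y x yx nxy; exists (inr k); case: (G'P k) => _; apply.
- by rewrite eqxy lexx in nxy.
Qed.

Theorem theorem1p3 (d : Order.disp_t) (P : finPOrderType d) :
  (pathwidth (@cover_graph d P) <= 2)%N -> (poset_dim P <= 17)%N.
Proof. by move=> /poset_dim_pathwidth2 /leq_trans; apply. Qed.
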